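(* Let $X$ be a pointed metric space. The topology $\tau_\gamma$ on $\mathrm{Lip}_0(X)$ is generated by the seminorms of the form $$p(f)=\sup_{n\in\mathbb{N}}\alpha_n\frac{|f(x_n)-f(y_n)|}{d(x_n,y_n)},\qquad f\in\mathrm{Lip}_0(X),$$ where $\{\alpha_n\}$ varies over all sequences in $\mathbb{R}^+$ tending to zero and $\{(x_n,y_n)\}$ runs over all sequences in $\widetilde X$.
   Context: $\mathbb{K}$ is $\mathbb{R}$ or $\mathbb{C}$. $(X,d)$ is a metric space with a distinguished base point $0$, and $\widetilde X=\{(x,y)\in X^2\colon x\ne y\}$. $\mathrm{Lip}_0(X)$ is the Banach space of all Lipschitz functions $f\colon X\to\mathbb{K}$ with $f(0)=0$, with norm $\mathrm{Lip}(f)=\sup\{|f(x)-f(y)|/d(x,y)\colon x,y\in X,\ x\ne y\}$ and closed unit ball $B_{\mathrm{Lip}_0(X)}$. $\tau_0$ is the compact-open topology on $\mathrm{Lip}_0(X)$ (uniform convergence on compact subsets of $X$). $\tau_\gamma$ is the mixed topology $\gamma[\mathrm{Lip},\tau_0]$ on $\mathrm{Lip}_0(X)$: the locally convex topology having as a base of neighborhoods of zero the sets $\gamma(U)=\bigcup_{n=1}^\infty\left(U_1\cap B_{\mathrm{Lip}_0(X)}+U_2\cap 2B_{\mathrm{Lip}_0(X)}+\cdots+U_n\cap 2^{n-1}B_{\mathrm{Lip}_0(X)}\right)$, where $U=\{U_n\}$ ranges over sequences of convex balanced $\tau_0$-neighborhoods of zero. *)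

(* Defs.v *)
From HB Require Import structures.
From mathcomp Require Import all_boot all_order all_algebra.
From mathcomp Require Import complex.
From mathcomp Require Import all_classical all_reals all_analysis.

Set Implicit Arguments.
Unset Strict Implicit.
Unset Printing Implicit Defensive.

Import Order.TTheory GRing.Theory Num.Theory.
Import numFieldTopology.Exports numFieldNormedType.Exports.

Local Open Scope classical_set_scope.
Local Open Scope ring_scope.

Variant scalar_kind := RealScalars | ComplexScalars.

Definition scalars (R : realType) (k : scalar_kind) : numFieldType :=
  match k with RealScalars => R | ComplexScalars => R[i] end.

(* The norm [`|z|] of z : R[i] is itself an element of R[i]; [modulus] is the
   absolute value with values in R. *)
Definition modulus (R : realType) (k : scalar_kind) : scalars R k -> R :=
  match k return scalars R k -> R with
  | RealScalars => fun z : R => `|z|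
  | ComplexScalars => @ComplexField.Normc.normc R
  end.

Section modulus_theory.
Context {R : realType} {k : scalar_kind}.
Implicit Types z w : scalars R k.

Lemma modulus0 : modulus (0 : scalars R k) = 0.
Proof. by case: k; [exact: normr0 | exact: ComplexField.Normc.normc0]. Qed.

Lemma modulus1 : modulus (1 : scalars R k) = 1.
Proof. by case: k; [exact: normr1 | exact: ComplexField.Normc.normc1]. Qed.

Lemma modulus_ge0 z : 0 <= modulus z.
Proof. by case: k z => [z|[a b]]; [exact: normr_ge0 | exact: sqrtr_ge0]. Qed.

Lemma modulusD z w : modulus (z + w) <= modulus z + modulus w.
Proof. by case: k z w => z w; [exact: ler_normD | exact: le_normcD]. Qed.

Lemma modulusM z w : modulus (z * w) = modulus z * modulus w.
Proof.
by case: k z w => z w; [exact: normrM | exact: ComplexField.Normc.normcM].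
Qed.

Lemma modulusV z : modulus z^-1 = (modulus z)^-1.
Proof.
by case: k z => z; [exact: normfV | exact: ComplexField.Normc.normcV].
Qed.

Lemma modulusMn z n : modulus (z *+ n) = modulus z *+ n.
Proof. by case: k z => z; [exact: normrMn | exact: normcMn]. Qed.

Lemma modulusX z n : modulus (z ^+ n) = modulus z ^+ n.
Proof.
by elim: n => [|n IHn]; rewrite ?expr0 ?modulus1// !exprS modulusM IHn.
Qed.

End modulus_theory.

Section Lip0.
Context {R : realType} (k : scalar_kind) {X : metricType R} (x0 : X).
Local Notation K := (scalars R k).

Definition lip0_pred : {pred X -> K^o} := fun f =>
  `[< f x0 = 0 /\
      exists C : R, forall x y, modulus (f x - f y : K) <= C * mdist x y >].

Lemma lip0_pred_submod : submod_closed lip0_pred.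
Proof.
split.
- apply/asboolP; split => //; exists 0 => x y.
  by rewrite subrr modulus0 mul0r.
- move=> a f g /asboolP[f0 [C Cf]] /asboolP[g0 [D Dg]]; apply/asboolP; split.
    by rewrite !fctE f0 g0 scaler0 addr0.
  exists (modulus a * C + D) => x y; rewrite !fctE.
  rewrite opprD addrACA -scalerBr mulrDl (le_trans (modulusD _ _))//.
  by rewrite lerD// modulusM -mulrA ler_wpM2l// modulus_ge0.
Qed.

HB.instance Definition _ :=
  GRing.isSubmodClosed.Build K (X -> K^o) lip0_pred lip0_pred_submod.

Record Lip0 := MkLip0 { lip0_fun :> X -> K^o ; _ : lip0_fun \in lip0_pred }.

HB.instance Definition _ := [isSub for lip0_fun].
HB.instance Definition _ := [Choice of Lip0 by <:].
HB.instance Definition _ := [SubChoice_isSubLmodule of Lip0 by <:].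

End Lip0.

Section mixed_topology.
Context {R : realType} (k : scalar_kind) {X : metricType R} (x0 : X).
Local Notation K := (scalars R k).
Local Notation E := (Lip0 k x0).
Implicit Types (f g : E) (U V : nat -> set E).

Definition Lip f : R :=
  sup [set r | exists x y : X,
         x <> y /\ r = modulus (f x - f y : K) / mdist x y].

Definition Lip0_ball : set E := [set f | Lip f <= 1].

(* subspace topology inherited from the compact-open topology on X -> K *)
Definition tau0 : Type :=
  initial_topology ((fun f => lip0_fun f) : E -> {compact-open, X -> K}).

HB.instance Definition _ := Topological.on tau0.

Definition balanced (A : set E) : Prop :=
  forall (a : K) f, `|a| <= 1 -> A f -> A (a *: f).

Definition tau0_disk : set (set E) :=
  [set A | [/\ convex_set A, balanced A & nbhs ((0 : E) : tau0) A]].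

(* Indexed from 0: the term of index i is U_{i+1} `&` 2^i B in the usual
   1-based notation. *)
Definition gamma_nbhs U : set E :=
  \bigcup_(n in [set: nat])
    [set f | exists2 h : 'I_n.+1 -> E,
       forall i : 'I_n.+1, (U i `&` [set 2 ^+ i *: g | g in Lip0_ball]) (h i)
       & f = \sum_i h i].

Definition mixed_topology : Type := E.

Definition mixed_nbhs (f : mixed_topology) : set_system mixed_topology :=
  filter_from [set U : nat -> set E | forall n, tau0_disk (U n)]
    (fun U => [set (f : E) + g | g in gamma_nbhs U]).

Lemma Lip0P f : f x0 = 0 /\
  exists C : R, forall x y, modulus (f x - f y : K) <= C * mdist x y.
Proof. by case: f => f /= /asboolP. Qed.

Lemma Lip_le f (C : R) : 0 <= C ->
  (forall x y, modulus (f x - f y : K) <= C * mdist x y) -> Lip f <= C.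
Proof.
move=> C0 fC; rewrite /Lip; set S := [set r | _].
have [->|/set0P S0] := eqVneq S set0; first by rewrite sup0.
apply: ge_sup => // _ [x [y [/eqP xy ->]]].
by rewrite ler_pdivrMr ?mdist_gt0.
Qed.

Lemma Lip_quot_le f x y : x <> y -> modulus (f x - f y : K) / mdist x y <= Lip f.
Proof.
move=> xy; apply: ub_le_sup; last by exists x, y.
have [_ [C fC]] := Lip0P f; exists C => _ [u [v [/eqP uv ->]]].
by rewrite ler_pdivrMr ?mdist_gt0.
Qed.

Lemma Lip_modulus_le f x y : modulus (f x - f y : K) <= Lip f * mdist x y.
Proof.
have [->|xy] := eqVneq x y; first by rewrite subrr modulus0 mdistxx mulr0.
by rewrite -ler_pdivrMr ?mdist_gt0// Lip_quot_le//; exact/eqP.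
Qed.

Lemma scaled_Lip0_ballP i f :
  [set 2 ^+ i *: g | g in Lip0_ball] f <->
  forall x y, modulus (f x - f y : K) <= 2 ^+ i * mdist x y.
Proof.
have m2 : modulus (2 ^+ i : K) = 2 ^+ i by rewrite modulusX modulusMn modulus1.
have p2 : (0 : R) < 2 ^+ i by rewrite exprn_gt0.
split=> [[g g1 <-] x y|f2].
  rewrite /= -scalerBr modulusM m2 ler_pM2l//.
  by rewrite (le_trans (Lip_modulus_le _ _ _))// ler_piMl// mdist_ge0.
exists ((2 ^+ i)^-1 *: f); last first.
  by rewrite scalerA divff ?scale1r// expf_neq0// pnatr_eq0.
apply: Lip_le => // x y /=.
by rewrite -scalerBr modulusM modulusV m2 mul1r ler_pdivrMl.
Qed.

Lemma tau0_disk0 A : tau0_disk A -> A 0.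
Proof. by case=> _ _; exact: nbhs_singleton. Qed.

Lemma tau0_diskT : tau0_disk setT.
Proof. by split => //; exact: filterT. Qed.

Lemma tau0_diskI A B : tau0_disk A -> tau0_disk B -> tau0_disk (A `&` B).
Proof.
move=> [cA bA nA] [cB bB nB]; split; last exact: filterI.
- move=> f g t; rewrite !in_setI => /andP[fA fB] /andP[gA gB].
  by rewrite cA//= cB.
- by move=> a f a1 [Af Bf]; split; [exact: bA | exact: bB].
Qed.

Lemma gamma_nbhs_seq U f : (forall n, tau0_disk (U n)) ->
  gamma_nbhs U f <-> exists (h : nat -> E) (n : nat),
    [/\ forall i, (U i `&` [set 2 ^+ i *: g | g in Lip0_ball]) (h i),
        forall i, (n < i)%N -> h i = 0 & f = \sum_(i < n.+1) h i].
Proof.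
move=> dU; split => [[n _ [h Uh ->]]|[h [n [Uh _ ->]]]]; last first.
  by exists n => //; exists (fun i => h i).
exists (fun i => if (i < n.+1)%N then h (inord i) else 0), n; split.
- move=> i; case: ifPn => [lin|_]; first by have := Uh (inord i); rewrite inordK.
  split; first exact: tau0_disk0.
  by apply/scaled_Lip0_ballP => x y; rewrite subrr modulus0 mulr_ge0// mdist_ge0.
- by move=> i; rewrite ltnNge => /negbTE; rewrite ltnS => ->.
- by apply: eq_bigr => i _; rewrite ltn_ord inord_val.
Qed.

Lemma gamma_nbhs0 U : (forall n, tau0_disk (U n)) -> gamma_nbhs U 0.
Proof.
move=> dU; apply/gamma_nbhs_seq => //; exists (fun=> 0), 0%N; split => //.
- move=> i; split; first exact: tau0_disk0.
  by apply/scaled_Lip0_ballP => x y; rewrite subrr modulus0 mulr_ge0// mdist_ge0.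
- by rewrite big1.
Qed.

Lemma gamma_nbhsS U V : (forall n, U n `<=` V n) ->
  gamma_nbhs U `<=` gamma_nbhs V.
Proof.
move=> UV f [n _ [h Uh ->]]; exists n => //; exists h => // i.
by have [Uhi hi] := Uh i; split => //; exact: UV.
Qed.

(* The terms of the two sums are interleaved. *)
Lemma gamma_nbhsD U f g : (forall n, tau0_disk (U n)) ->
  let V n := U n.*2 `&` U n.*2.+1 in
  gamma_nbhs V f -> gamma_nbhs V g -> gamma_nbhs U (f + g).
Proof.
move=> dU V; have dV n : tau0_disk (V n) by exact: tau0_diskI.
move=> /(gamma_nbhs_seq _ dV)[h [n [Vh h0 ->]]].
move=> /(gamma_nbhs_seq _ dV)[l [m [Vl l0 ->]]].
have pad (u : nat -> E) p N : (forall i, (p < i)%N -> u i = 0) -> (p < N)%N ->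
    \sum_(i < p.+1) u i = \sum_(i < N) u i.
  move=> u0 pN; rewrite (big_ord_widen N u pN).
  rewrite [RHS](bigID (fun i : 'I_N => (i < p.+1)%N))/=.
  rewrite [X in _ = _ + X]big1 ?addr0// => i.
  by rewrite -leqNgt => /u0.
pose N := (n + m).+1.
have nN : (n < N)%N by rewrite ltnS leq_addr.
have mN : (m < N)%N by rewrite ltnS leq_addl.
rewrite (pad _ _ _ h0 nN) (pad _ _ _ l0 mN).
pose u i := if odd i then l i./2 else h i./2.
have -> : \sum_(i < N) h i + \sum_(i < N) l i = \sum_(i < N.*2) u i.
  elim: N {nN mN} => [|N IH]; first by rewrite double0 !big_ord0 addr0.
  rewrite doubleS !big_ord_recr/= -IH /u /= odd_double doubleK uphalf_double.
  by rewrite addrACA !addrA.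
exists N.*2.-1 => //.
exists (fun i => u i) => // - [i /= _]; rewrite /u.
have grow j : (j <= i)%N -> [set 2 ^+ j *: g | g in Lip0_ball] `<=`
    [set 2 ^+ i *: g | g in Lip0_ball].
  move=> ji w /scaled_Lip0_ballP w2; apply/scaled_Lip0_ballP => x y.
  by rewrite (le_trans (w2 x y))// ler_wpM2r ?mdist_ge0// ler_eXn2l// ltr1n.
have hi : (i./2 <= i)%N by rewrite leq_half_double -addnn (leq_trans (leq_addr i i)).
have := odd_double_half i; case: (odd i) => /= ei.
- have [[_ Ul] /(grow _ hi) gl] := Vl i./2; split => //.
  by rewrite -[X in U X]ei.
- have [[Uh _] /(grow _ hi) gh] := Vh i./2; split => //.
  by rewrite -[X in U X]ei.
Qed.

Lemma mixed_nbhs_filter (f : mixed_topology) : ProperFilter (mixed_nbhs f).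
Proof.
split.
  by move=> [U dU /(_ _ (imageP _ (gamma_nbhs0 dU)))].
apply: filter_from_filter; first by exists (fun=> setT) => n; exact: tau0_diskT.
move=> U V dU dV; exists (fun n => U n `&` V n) => [n|]; first exact: tau0_diskI.
by move=> _ [g UVg <-]; split; exists g => //; apply: gamma_nbhsS UVg => n h [].
Qed.

Lemma mixed_nbhs_singleton (f : mixed_topology) (A : set mixed_topology) :
  mixed_nbhs f A -> A f.
Proof.
move=> [U dU]; apply; exists 0; last by rewrite addr0.
exact: gamma_nbhs0.
Qed.

Lemma mixed_nbhs_nbhs (f : mixed_topology) (A : set mixed_topology) :
  mixed_nbhs f A -> mixed_nbhs f (mixed_nbhs^~ A).
Proof.
move=> [U dU UA]; exists (fun n => U n.*2 `&` U n.*2.+1) => [n|].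
  exact: tau0_diskI.
move=> _ [g Vg <-]; exists (fun n => U n.*2 `&` U n.*2.+1) => [n|].
  exact: tau0_diskI.
move=> _ [h Vh <-]; apply: UA; exists (g + h); last by rewrite addrA.
exact: gamma_nbhsD.
Qed.

HB.instance Definition _ := Choice.on mixed_topology.
HB.instance Definition _ := hasNbhs.Build mixed_topology mixed_nbhs.
HB.instance Definition _ := Nbhs_isNbhsTopological.Build mixed_topology
  mixed_nbhs_filter mixed_nbhs_singleton mixed_nbhs_nbhs.

End mixed_topology.

(* The topology generated by a family P of seminorms: the open semiballs
   [set f | p (f - g) < e] form a subbase. *)
Definition seminorm_topology (R : realType) (E : zmodType) (P : set (E -> R))
  : Type := E.

Section seminorm_topology.
Context {R : realType} {E : zmodType} (P : set (E -> R)).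

HB.instance Definition _ := Choice.on (seminorm_topology P).
HB.instance Definition _ :=
  isSubBaseTopological.Build (seminorm_topology P)
    [set A : set E | exists p g (e : R),
       [/\ P p, 0 < e & A = [set f | p (f - g) < e]]] id.

End seminorm_topology.

Section lip_seminorms.
Context {R : realType} (k : scalar_kind) {X : metricType R} (x0 : X).
Local Notation K := (scalars R k).
Local Notation E := (Lip0 k x0).

Definition offdiag : set (X * X) := [set xy | xy.1 <> xy.2].

Definition lip_seminorm (alpha : nat -> R) (xy : nat -> X * X) (f : E) : R :=
  sup (range (fun n => alpha n *
    (modulus (f (xy n).1 - f (xy n).2 : K) / mdist (xy n).1 (xy n).2))).

Definition lip_seminorms : set (E -> R) :=
  [set p | exists (alpha : nat -> R) (xy : nat -> X * X),
     [/\ forall n, 0 < alpha n, alpha @ \oo --> 0,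
         forall n, offdiag (xy n) & p = lip_seminorm alpha xy]].

(* The supremum is finite. *)
Lemma lip_seminorm_has_sup (alpha : nat -> R) (xy : nat -> X * X) (f : E) :
  (forall n, 0 < alpha n) -> alpha @ \oo --> 0 -> (forall n, offdiag (xy n)) ->
  has_sup (range (fun n => alpha n *
    (modulus (f (xy n).1 - f (xy n).2 : K) / mdist (xy n).1 (xy n).2))).
Proof.
move=> a0 acvg oxy; split; first by eexists; exists 0%N.
have /cvg_seq_bounded[M [_ /(_ (M + 1))]] : cvgn alpha by exact/cvgP/acvg.
rewrite ltrDl ltr01 => /(_ isT) aM.
exists ((M + 1) * Lip f) => _ [n _ <-].
apply: ler_pM; [exact: ltW| | |by apply: Lip_quot_le; exact: oxy].
- by rewrite divr_ge0 ?modulus_ge0 ?mdist_ge0.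
- by apply: le_trans (ler_norm _) _; exact: aM.
Qed.

End lip_seminorms.

Arguments lip_seminorms {R} k {X} x0 _.

(* Main.v *)
Require Import Defs.
From mathcomp Require Import finmap.
From mathcomp Require Import all_boot all_order all_algebra.
From mathcomp Require Import complex.
From mathcomp Require Import all_classical all_reals all_analysis.
From mathcomp Require Import ring lra.

(** The proof compares neighbourhoods.

    A Lipschitz seminorm is continuous for the mixed topology by a geometric
    splitting.  On the i-th summand of an element of a basic mixed
    neighbourhood, all but finitely many of the weighted slopes are at most
    [e / 2 ^ (i + 1)] merely because the summand has Lipschitz constant
    [2 ^ i] and the weights tend to zero; the finitely many remaining ones are
    made as small by the choice of [U i], which is a condition at finitely
    many points.  Summing over i bounds the whole seminorm by [e]
    ([gamma_nbhs_small_slopes]).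

    The converse is an argument in the style of Banach and Dieudonne.  Two facts
    make it work.  On sets with bounded Lipschitz constant the compact-open
    topology is that of pointwise convergence, by equicontinuity
    ([tau0_nbhs_lip]); hence a mixed-open set [U] is relatively open for
    pointwise convergence in each ball ([mixed_open_bounded_ptw_open]).  And
    the balls are compact for pointwise convergence, by Tychonoff's theorem
    ([ptw_bounded_cluster]).

    Take such a [U] containing 0.  It contains a small ball, of radius [r 0].
    Let [r n] increase to infinity, and suppose that every function of the ball
    of radius [r n] subject to certain finitely many bounds on slopes is in
    [U].  Then finitely many further bounds by [r n] suffice for the
    ball of radius [r n.+1]: otherwise, by compactness, some function with all
    slopes at most [r n], satisfying the earlier bounds, would be a pointwise
    limit of functions outside [U], although it is in [U]
    ([exists_finite_slopes]).  The finite sets of pairs so obtained, with the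
    weight [(r n)^-1] for those of stage n, are arranged in a single sequence
    ([enumerate_finite_levels]).  The weights tend to zero, and the open unit
    ball of the seminorm which they define is contained in [U], as every
    function belongs to one of the balls ([seminorm_ball_sub]).  A one-point
    space has no pair of distinct points, hence no seminorm, but then the
    function space is zero. *)

Set Implicit Arguments.
Unset Strict Implicit.
Unset Printing Implicit Defensive.

Import Order.TTheory GRing.Theory Num.Theory.
Import numFieldTopology.Exports numFieldNormedType.Exports.

Local Open Scope classical_set_scope.
Local Open Scope ring_scope.

(** * Scalars *)

Section scalars.
Context {R : realType} {k : scalar_kind}.
Local Notation K := (scalars R k).
Implicit Types z w : K.

Lemma modulus_eq0 z : modulus z = 0 -> z = 0.
Proof.
by case: k z => z; [exact: normr0_eq0 | exact: ComplexField.Normc.eq0_normc].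
Qed.

Lemma modulusN z : modulus (- z) = modulus z.
Proof. by case: k z => z; [exact: normrN | exact: normcN]. Qed.

(** In the complex case the hypothesis is an inequality between complex
    numbers; this brings conditions stated with the norm of the scalar field
    into the real-valued modulus. *)
Lemma modulus_le1 z : `|z| <= 1 -> modulus z <= 1.
Proof. by case: k z => z //; rewrite /= normc_def lecR; case: z. Qed.

(** In the complex case [0 <= z] forces z to be real, which is why coefficients
    of convex combinations have moduli that add up to 1. *)
Lemma modulus_convex z : 0 <= z -> z <= 1 -> modulus z + modulus (1 - z) = 1.
Proof.
case: k z => z /=.
  by move=> z0 z1; rewrite !ger0_norm ?subr_ge0// addrC subrK.
case: z => a b; rewrite !lecE/= => /andP[/eqP-> a0] /andP[_ a1].
rewrite oppr0 addr0 expr0n/= !addr0 !sqrtr_sqr !ger0_norm ?subr_ge0//.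
by rewrite addrC subrK.
Qed.

(** The radii of the balls of the complex field are positive complex numbers,
    hence real, so that real radii give the same topology. *)
Lemma nbhs_modulusP z (B : set K) :
  nbhs z B <-> exists2 e : R, 0 < e & forall w, modulus (w - z) < e -> B w.
Proof.
case: k z B => z B; split.
- move=> /nbhs_normP[e /= e0 eB]; exists e => // w we; apply: eB.
  by rewrite /= distrC.
- move=> [e e0 eB]; apply/nbhs_normP; exists e => // w /= we; apply: eB.
  by rewrite /= distrC.
- move=> /nbhs_normP[[e f]] /=; rewrite ltcE/= => /andP[/eqP-> e0] eB.
  exists e => // w we; apply: eB => /=.
  by rewrite distrC normc_def ltcR; case: (w - z) we.
- move=> [e e0 eB]; apply/nbhs_normP; exists e%:C%C => /=; first by rewrite ltcR.
  move=> w /=; rewrite distrC normc_def ltcR => we; apply: eB.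
  by case: (w - z) we.
Qed.

End scalars.

(** Tychonoff's theorem only needs a compact set around each disk: a segment
    over the reals, a square over the complex numbers. *)
Lemma compact_disk (R : realType) k (M : R) :
  exists2 C : set (scalars R k), compact C & forall z, modulus z <= M -> C z.
Proof.
case: k.
  exists ([set` `[- M, M]] : set R) => [|z zM]; first exact: segment_compact.
  by rewrite /= in_itv/= -ler_norml.
pose f (p : R * R) : scalars R ComplexScalars := (p.1 +i* p.2)%C.
exists (f @` (`[- M, M] `*` `[- M, M])).
  apply: continuous_compact; last first.
    by apply: compact_setX; exact: segment_compact.
  apply: continuous_subspaceT => -[a b] B /nbhs_modulusP[e e0 eB].
  exists (ball a (e / 2), ball b (e / 2)); first by split; apply: nbhsx_ballx; exact: divr_gt0.
  move=> [c d] [/= ac bd]; apply: eB.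
  have -> : f (c, d) - f (a, b) = f (c - a, 0) + f (0, d - b).
    by rewrite /f/=; simpc.
  apply: le_lt_trans (modulusD _ _) _.
  rewrite /= expr0n/= addr0 add0r !sqrtr_sqr.
  by rewrite (splitr e) ltrD// distrC.
move=> [a b] abM; exists (a, b) => //=.
have abs (c d : R) : Num.sqrt (c ^+ 2 + d ^+ 2) <= M -> c \in `[- M, M].
  move=> cdM; rewrite in_itv/= -ler_norml (le_trans _ cdM)//.
  by rewrite -sqrtr_sqr ler_wsqrtr// lerDl sqr_ge0.
by split => /=; [exact: (abs _ b) | apply: (abs _ a); rewrite addrC].
Qed.

(** * Bounded slopes and pointwise limits *)

Section lip_balls.
Context {R : realType} {k : scalar_kind} {X : metricType R}.
Local Notation K := (scalars R k).
Implicit Types (f g : X -> K) (r s : R) (c : seq (X * X * R)).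

Definition lip_le r f := forall x y, modulus (f x - f y) <= r * mdist x y.

(** The bounds are kept in a finite list so that, during the inductive choice of
    pairs, finitely many evaluations decide membership, and so that the
    condition is closed under pointwise limits. *)
Definition slopes_le c f := forall q t, (q, t) \in c ->
  modulus (f q.1 - f q.2) <= t * mdist q.1 q.2.

Lemma lip_leB r s f g : lip_le r f -> lip_le s g ->
  lip_le (r + s) (fun x => f x - g x).
Proof.
move=> rf sg x y; rewrite mulrDl.
have -> : f x - g x - (f y - g y) = (f x - f y) - (g x - g y) by ring.
by rewrite (le_trans (modulusD _ _))// modulusN lerD.
Qed.

Lemma lip_le_modulus r f x0 x : f x0 = 0 -> lip_le r f ->
  modulus (f x) <= r * mdist x x0.
Proof. by move=> f0 /(_ x x0); rewrite f0 subr0. Qed.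

Lemma modulusB_le_approx (z w : K) (t : R) :
  (forall e, 0 < e -> exists z' w' : K,
     [/\ modulus (z' - z) < e, modulus (w' - w) < e & modulus (z' - w') <= t]) ->
  modulus (z - w) <= t.
Proof.
move=> approx; apply/ler_addgt0Pr => e e0.
have [z' [w' [zz ww zwt]]] := approx _ (divr_gt0 e0 (ltr0Sn R 1)).
have -> : z - w = (z' - w') - (z' - z) + (w' - w) by ring.
rewrite (splitr e) [leRHS]addrA (le_trans (modulusD _ _))// lerD ?(ltW ww)//.
by rewrite (le_trans (modulusD _ _))// modulusN lerD// ltW.
Qed.

Lemma slopes_le_approx c f :
  (forall (P : seq X) e, 0 < e -> exists2 g, slopes_le c g &
     {in P, forall p, modulus (g p - f p) < e}) -> slopes_le c f.
Proof.
move=> approx q t qt; apply: modulusB_le_approx => e e0.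
have [g cg gf] := approx [:: q.1; q.2] e e0.
by exists (g q.1), (g q.2); split; [apply: gf..|exact: cg];
  rewrite !inE eqxx ?orbT.
Qed.

(** This is Tychonoff's theorem, stated with the finitely many points and the
    tolerance that describe a pointwise neighbourhood of the cluster point. *)
Lemma ptw_bounded_cluster (M : X -> R) (F : set_system (X -> K)) :
  ProperFilter F -> F [set g | forall x, modulus (g x) <= M x] ->
  exists f, forall (A : set (X -> K)) (P : seq X) e, F A -> 0 < e ->
    exists2 g, A g & {in P, forall p, modulus (g p - f p) < e}.
Proof.
move=> FF FM.
have /choice[C CP] x : exists C : set K,
    compact C /\ forall z, modulus z <= M x -> C z.
  by have [C] := @compact_disk R k (M x); exists C.
have := @tychonoff X (fun=> K) C (fun x => (CP x).1).
move=> /(_ F FF)[|f [_ Ff]].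
  by apply: filterS FM => g gM x; apply: (CP x).2.
exists f => A P e FA e0.
suff : nbhs (f : {ptws X -> K})
    [set g | {in P, forall p, modulus (g p - f p) < e}].
  by move=> /(Ff _ _ FA)[g [Ag Pg]]; exists g.
have ? : Filter (nbhs (f : {ptws X -> K})) by exact: nbhs_filter.
elim: P => [|p P IHP].
  by rewrite (_ : [set _ | _] = setT) ?predeqE//; exact: filterT.
have fp : nbhs (f : {ptws X -> K}) [set g | modulus (g p - f p) < e].
  apply: (@proj_continuous X (fun=> K) p f [set z | modulus (z - f p) < e]).
  by apply/nbhs_modulusP; exists e.
apply: filterS2 fp IHP => g gp gP q; rewrite inE => /orP[/eqP->//|].
exact: gP.
Qed.

End lip_balls.

(** * The compact-open topology on Lipschitz balls *)

Section tau0.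
Context {R : realType} {k : scalar_kind} {X : metricType R} {x0 : X}.
Local Notation K := (scalars R k).
Local Notation E := (Lip0 k x0).
Implicit Types (f g : E) (r : R).

Lemma Lip0_at0 f : f x0 = 0.
Proof. by have [] := Lip0P f. Qed.

Lemma Lip0_lip_le f : lip_le (Lip f) f.
Proof. by move=> x y; exact: Lip_modulus_le. Qed.

Lemma lip_le_Lip0 r (f : X -> K) : f x0 = 0 -> lip_le r f ->
  exists g : E, lip0_fun g = f.
Proof.
move=> f0 rf; have Lf : f \in @lip0_pred R k X x0 by apply/asboolP; split => //; exists r.
by exists (MkLip0 Lf).
Qed.

Lemma tau0_nbhs_eval x e : 0 < e ->
  nbhs ((0 : E) : tau0 k x0) [set f : E | modulus (f x : K) < e].
Proof.
move=> e0; pose O : set K := interior [set z : K | modulus z < e].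
have cx : compact [set x] by exact: compact_set1.
have oO : open O by exact: open_interior.
have O0 : O 0.
  by apply/nbhs_modulusP; exists e => // z; rewrite subr0.
have nO : nbhs ((0 : E) : {compact-open, X -> K}) [set g | g @` [set x] `<=` O].
  apply: open_nbhs_nbhs; split; first exact: compact_open_open.
  by move=> _ [y _ <-].
have := @initial_continuous E {compact-open, X -> K} (fun f => lip0_fun f) 0 _ nO.
move=> nE; have FF : Filter (nbhs ((0 : E) : tau0 k x0)) by exact: nbhs_filter.
apply: (@filterS _ _ FF _ _ _ nE) => f fO.
have /interior_subset// : O (f x) by apply: fO; exists x.
Qed.

(** A common Lipschitz constant spreads smallness from a point to a ball of
    fixed radius, and finitely many such balls cover a compact set; so pointwise
    smallness at finitely many points controls a compact-open neighbourhood. *)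
Lemma tau0_nbhs_lip r (U : set E) : nbhs ((0 : E) : tau0 k x0) U ->
  exists2 e, 0 < e & exists P : seq X, forall f, lip_le r f ->
    {in P, forall p, modulus (f p : K) < e} -> U f.
Proof.
case=> _ [] [V oV <-] /= V0 VU.
pose W (i : seq X * R) : set (X -> K) :=
  [set g | lip_le r g /\ {in i.1, forall p, modulus (g p) < i.2}].
pose F : set_system {compact-open, X -> K} := filter_from [set i | 0 < i.2] W.
have FF : Filter F.
  apply: filter_from_filter; first by exists ([::], 1) => /=.
  move=> [P e] [Q d] /= e0 d0; exists (P ++ Q, Num.min e d).
    by rewrite /= lt_min e0.
  move=> g [rg] /= gPQ; split; (split=> // p pP; have := gPQ p).
    by rewrite mem_cat pP/= lt_min => /(_ isT)/andP[].
  by rewrite mem_cat pP/= orbT lt_min => /(_ isT)/andP[].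
suff /(_ _ (open_nbhs_nbhs (conj oV V0)))[[P e] /= e0 WV] :
    F --> ((0 : E) : {compact-open, X -> K}).
  by exists e => //; exists P => f rf fP; apply: VU; exact: WV.
apply/compact_open_cvgP => C O /compact_near_coveringP cC oO C0O.
have near_O : \forall g \near F, C `<=` (fun x => O (g x)).
  apply: cC => x Cx.
  have /nbhs_modulusP[e e0 eO] : nbhs (0 : K) O.
    by apply: open_nbhs_nbhs; split => //; apply: C0O; exists x.
  (* The radius d lets an r-Lipschitz function vary by less than e / 2; the
     absolute value and the 1 keep the denominator positive for every r. *)
  pose d := e / 2 / (`|r| + 1).
  have r1 : 0 < `|r| + 1 by rewrite ltr_wpDl.
  have d0 : 0 < d by rewrite !divr_gt0.
  exists (ball x d, W ([:: x], e / 2)); first split => /=.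
  - exact: nbhsx_ballx.
  - by exists ([:: x], e / 2) => //=; rewrite divr_gt0.
  move=> [y g] [/= + [rg gx]]; rewrite ballEmdist/= => xyd.
  apply: eO; rewrite subr0 -(subrK (g x) (g y)).
  rewrite (splitr e) (le_lt_trans (modulusD _ _))// ltrD//; last first.
    by apply: gx; rewrite inE.
  rewrite (le_lt_trans (rg y x))// metric_sym.
  rewrite (@le_lt_trans _ _ ((`|r| + 1) * mdist x y))//.
    by rewrite ler_wpM2r ?mdist_ge0// (le_trans (ler_norm r))// lerDl.
  by rewrite mulrC -ltr_pdivlMr.
by apply: filterS near_O => g CO _ [x Cx <-]; exact: CO.
Qed.

End tau0.

(** * Choosing finitely many slopes at each stage *)

Section banach_dieudonne.
Context {R : realType} {k : scalar_kind} {X : metricType R} {x0 : X}.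
Local Notation K := (scalars R k).
Local Notation E := (Lip0 k x0).
Implicit Types (f g : E) (U : set E) (r s : R) (c : seq (X * X * R)).

(** Relative openness for pointwise convergence in Lipschitz balls; bounding
    [g - f] instead of [g] changes nothing, as f has a Lipschitz constant. *)
Definition bounded_ptw_open U := forall f r, U f ->
  exists2 e, 0 < e & exists P : seq X, forall g, lip_le r (g - f) ->
    {in P, forall p, modulus (g p - f p : K) < e} -> U g.

(** The compactness step.  If no finite set F worked, the functions that violate
    the conclusion for the various F would form a filter base; a
    pointwise cluster point has all its slopes bounded by s, hence lies in U,
    while being a limit of functions outside the relatively open set U. *)
Lemma exists_finite_slopes U c r s : bounded_ptw_open U ->
  (forall f, lip_le s f -> slopes_le c f -> U f) ->
  exists F : seq (X * X), forall f, lip_le r f ->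
    slopes_le (c ++ [seq (q, s) | q <- F]) f -> U f.
Proof.
move=> openU sU; apply: contrapT => noF.
pose W (F : seq (X * X)) : set (X -> K) := [set g | exists f : E,
  [/\ lip0_fun f = g, lip_le r f, slopes_le c f,
      slopes_le [seq (q, s) | q <- F] f & ~ U f]].
have W0 F : W F !=set0.
  apply: contrapT => WF0; apply: noF; exists F => f rf cf.
  apply: contrapT => Uf; apply: WF0; exists f, f; split => //.
    by move=> q t qt; apply: cf; rewrite mem_cat qt.
  by move=> q t qt; apply: cf; rewrite mem_cat qt orbT.
have FW : ProperFilter (filter_from setT W).
  apply: filter_from_proper => [|F _]; last exact: W0.
  apply: filter_from_filter; first by exists [::].
  move=> F G _ _; exists (F ++ G) => // g [f [fg rf cf]].
  rewrite map_cat => FGf Uf; split; exists f; split => // q t qt; apply: FGf.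
    by rewrite mem_cat qt.
  by rewrite mem_cat qt orbT.
have [|phi phiP] := ptw_bounded_cluster (M := fun x => r * mdist x x0) FW.
  exists [::] => // _ [f [<- rf _ _ _]] x.
  by apply: lip_le_modulus => //; exact: Lip0_at0.
have {}phiP F (P : seq X) e : 0 < e -> exists f : E,
    [/\ lip_le r f, slopes_le c f, slopes_le [seq (q, s) | q <- F] f, ~ U f &
        {in P, forall p, modulus (f p - phi p) < e}].
  by move=> e0; have [|_ [f [<- ? ? ? ?]] ?] := phiP (W F) P e _ e0;
    [exists F | exists f].
have phi0 : phi x0 = 0.
  apply: modulus_eq0; apply/eqP; rewrite eq_le modulus_ge0 andbT.
  rewrite -[phi x0]subr0; apply: modulusB_le_approx => e e0.
  have [f [_ _ _ _ fP]] := phiP [::] [:: x0] e e0.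
  exists (f x0), 0; split; first by apply: fP; rewrite inE.
    by rewrite subrr modulus0.
  by rewrite Lip0_at0 subrr modulus0.
have sphi : lip_le s phi.
  move=> x y; apply: modulusB_le_approx => e e0.
  have [f [_ _ Ff _ fP]] := phiP [:: (x, y)] [:: x; y] e e0.
  exists (f x), (f y); split; [by apply: fP; rewrite !inE eqxx ?orbT..|].
  by apply: (Ff (x, y)); rewrite inE.
have cphi : slopes_le c phi.
  apply: slopes_le_approx => P e e0; have [f [_ cf _ _ fP]] := phiP [::] P e e0.
  by exists f.
have [f fphi] := lip_le_Lip0 phi0 sphi; move: sphi cphi phiP.
rewrite -fphi => sf cf fP.
have [e e0 [P Pf]] := openU f (r + s) (sU _ sf cf).
(* The limit f has constant s and the approximant g has constant r, so their
   difference has constant r + s. *)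
have [g [rg _ _ Ug gP]] := fP [::] P e e0.
by apply: Ug; apply: Pf => //; exact: lip_leB.
Qed.

Lemma exists_slopes_sequence U (r : nat -> R) : bounded_ptw_open U ->
  (forall f, lip_le (r 0%N) f -> U f) ->
  exists F : nat -> seq (X * X), forall n f, lip_le (r n) f ->
    (forall m, (m < n)%N -> slopes_le [seq (q, r m) | q <- F m] f) -> U f.
Proof.
move=> openU U0.
have /choice[G GP] (cn : seq (X * X * R) * nat) : exists F : seq (X * X),
    (forall f, lip_le (r cn.2) f -> slopes_le cn.1 f -> U f) ->
    forall f, lip_le (r cn.2.+1) f ->
      slopes_le (cn.1 ++ [seq (q, r cn.2) | q <- F]) f -> U f.
  (* Weakened to an implication, so that the choice function is defined on all
     lists; the induction below supplies the premise. *)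
  have [cU|ncU] := pselect (forall f, lip_le (r cn.2) f -> slopes_le cn.1 f -> U f).
    by have [F FU] := exists_finite_slopes (r cn.2.+1) openU cU; exists F.
  by exists [::].
pose c := fix c n := if n is m.+1
  then c m ++ [seq (q, r m) | q <- G (c m, m)] else [::].
have cU n f : lip_le (r n) f -> slopes_le (c n) f -> U f.
  elim: n f => [|n IHn] f; first by move=> /U0.
  exact: (GP (c n, n)).
exists (fun n => G (c n, n)) => n f rf Gf; apply: cU rf _.
elim: n Gf => [_ q t|n IHn Gf q t]; first by rewrite in_nil.
rewrite /= mem_cat => /orP[|qt]; last exact: Gf qt.
by apply: IHn => m mn; apply: Gf; rewrite ltnW.
Qed.

End banach_dieudonne.

(** Each level is finite, so only finitely many indices carry a weight
    [a m] with m below a given bound, and the weights tend to zero along the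
    enumeration.  Indices that code no element get the point d with the
    harmonic weight, so that the weights stay positive and tend to zero. *)
Lemma enumerate_finite_levels (R : realType) (T : eqType) (d : T)
    (F : nat -> seq T) (a : nat -> R) : (forall n, 0 < a n) -> a @ \oo --> 0 ->
  exists (alpha : nat -> R) (x : nat -> T),
    [/\ forall i, 0 < alpha i, alpha @ \oo --> 0 &
        forall n t, t \in F n -> exists i, alpha i = a n /\ x i = t].
Proof.
move=> a0 acvg.
pose dec i : option (nat * T) :=
  if @pickle_inv (nat * nat)%type i is Some p then
    if (p.2 < size (F p.1))%N then Some (p.1, nth d (F p.1) p.2) else None
  else None.
pose alpha i := if dec i is Some p then a p.1 else i.+1%:R^-1.
pose x i := if dec i is Some p then p.2 else d.
exists alpha, x; split => [i| |n t tF].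
- by rewrite /alpha; case: (dec i) => [p|]; rewrite ?invr_gt0.
- apply/cvgr0Pnorm_lt => e e0.
  have [N _ aN] : \forall n \near \oo, `|a n| < e by exact: cvgr0_norm_lt.
  pose M := \max_(n < N) \max_(j < size (F n))
    (@pickle (nat * nat)%type (nat_of_ord n, nat_of_ord j)).+1.
  near=> i; rewrite /alpha /dec.
  have small : `|i.+1%:R^-1 : R| < e.
    by near: i; apply: cvgr0_norm_lt => //; exact: (@cvg_harmonic R).
  case E : (pickle_inv i) => [[n j]|//] /=; case: ifPn => //= jF.
  apply: aN => /=; rewrite leqNgt; apply/negP => nN.
  have : (i.+1 <= M)%N.
    have <- : @pickle (nat * nat)%type (n, j) = i.
      by have := @pickle_invK (nat * nat)%type i; rewrite E.
    apply: (leq_trans _ (leq_bigmax (Ordinal nN))) => /=.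
    exact: (leq_trans _ (leq_bigmax (Ordinal jF))).
  by apply/negP; rewrite -leqNgt; near: i; exists M => // i /= Mi; rewrite ltnW.
- exists (@pickle (nat * nat)%type (n, index t (F n))).
  by rewrite /alpha /x /dec pickleK_inv /= index_mem tF /= nth_index.
Unshelve. all: by end_near. Qed.

(** * Lipschitz seminorms and the mixed topology *)

Section mixed.
Context {R : realType} {k : scalar_kind} {X : metricType R} {x0 : X}.
Local Notation K := (scalars R k).
Local Notation E := (Lip0 k x0).
Implicit Types (f g : E) (A U : set E) (r s : R) (c : seq (X * X * R)).

Lemma tau0_disk_slopes_le c : (forall q t, (q, t) \in c -> 0 < t) ->
  tau0_disk [set f : E | slopes_le c f].
Proof.
move=> c0; split.
- move=> f g l; rewrite !inE /= => cf cg q t qt.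
  have l01 := modulus_convex (ge0 l) (le1 l).
  pose a : K := l%:num; pose b : K := 1 - l%:num.
  change (modulus ((a *: f + b *: g : E) q.1 - (a *: f + b *: g : E) q.2 : K)
    <= t * mdist q.1 q.2).
  have -> : (a *: f + b *: g : E) q.1 - (a *: f + b *: g : E) q.2 =
      a * (f q.1 - f q.2) + b * (g q.1 - g q.2) :> K.
    by rewrite !mulrBr addrACA opprD.
  rewrite (le_trans (modulusD _ _))// !modulusM.
  rewrite -[t * _]mul1r -l01 mulrDl.
  by rewrite lerD// ler_wpM2l ?modulus_ge0//; [exact: cf|exact: cg].
- move=> a f /modulus_le1 a1 cf q t qt.
  have -> : (a *: f) q.1 - (a *: f) q.2 = a * (f q.1 - f q.2) :> K.
    by rewrite mulrBr.
  by rewrite modulusM (le_trans _ (cf _ _ qt))// ler_piMl// modulus_ge0.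
have FF : Filter (nbhs ((0 : E) : tau0 k x0)) by exact: nbhs_filter.
elim: c c0 => [|[q t] c IHc] c0.
  by apply: (@filterS _ _ FF _ _ _ filterT) => f _ q t; rewrite in_nil.
have t0 : 0 < t by apply: (c0 q); rewrite inE eqxx.
have nc : nbhs ((0 : E) : tau0 k x0) [set f : E | slopes_le c f].
  by apply: IHc => p s ps; apply: (c0 p); rewrite inE ps orbT.
have nq : nbhs ((0 : E) : tau0 k x0)
    [set f : E | modulus (f q.1 - f q.2 : K) <= t * mdist q.1 q.2].
  have [->|q12] := eqVneq q.1 q.2.
    apply: (@filterS _ _ FF _ _ _ filterT) => f _ /=.
    by rewrite subrr modulus0 mdistxx mulr0.
  have e0 : 0 < t * mdist q.1 q.2 / 2 by rewrite divr_gt0// mulr_gt0// mdist_gt0.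
  apply: (@filterS2 _ _ FF _ _ _ _ (tau0_nbhs_eval q.1 e0) (tau0_nbhs_eval q.2 e0)).
  move=> f f1 f2 /=; rewrite (le_trans (modulusD _ _))// modulusN.
  by rewrite (splitr (t * _)) lerD// ltW.
apply: (@filterS2 _ _ FF _ _ _ _ nq nc) => f fq fc p s.
by rewrite inE => /orP[/eqP[-> ->]//|]; exact: fc.
Qed.

Lemma sum_half_powers n : \sum_(i < n) (2^-1 : R) ^+ i.+1 <= 1.
Proof.
suff -> : \sum_(i < n) (2^-1 : R) ^+ i.+1 = 1 - 2^-1 ^+ n.
  by rewrite lerBlDr lerDl exprn_ge0// invr_ge0.
elim: n => [|n IHn]; first by rewrite big_ord0 expr0 subrr.
by rewrite big_ord_recr/= IHn exprS; lra.
Qed.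

Definition slope (f : X -> K) (q : X * X) : R :=
  modulus (f q.1 - f q.2) / mdist q.1 q.2.

Lemma slopeD (f g : X -> K) q : slope (fun x => f x + g x) q <= slope f q + slope g q.
Proof.
rewrite /slope -mulrDl ler_wpM2r ?invr_ge0 ?mdist_ge0//.
by rewrite opprD addrACA modulusD.
Qed.

Lemma slope_sum n (h : 'I_n -> E) q :
  slope (\sum_(i < n) h i) q <= \sum_(i < n) slope (h i) q.
Proof.
elim: n h => [|n IHn] h.
  by rewrite !big_ord0 /slope /= subrr modulus0 mul0r.
rewrite !big_ord_recr/= (le_trans (slopeD _ _ _))// lerD2r; exact: IHn.
Qed.

(** The summand of index i gets the share [e / 2 ^ (i + 1)] of the bound e: its
    Lipschitz constant [2 ^ i] takes care of the indices with small weight,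
    the neighbourhood [U i] of the finitely many others. *)
Lemma gamma_nbhs_small_slopes (alpha : nat -> R) (xy : nat -> X * X) e :
  0 < e -> (forall n, 0 < alpha n) -> alpha @ \oo --> 0 ->
  (forall n, offdiag (xy n)) ->
  exists2 U : nat -> set E, forall n, tau0_disk (U n) &
    forall f, gamma_nbhs U f -> forall n, alpha n * slope f (xy n) <= e.
Proof.
move=> e0 a0 acvg oxy.
pose b i : R := e * 2^-1 ^+ i.+1.
have b0 i : 0 < b i by rewrite mulr_gt0// exprn_gt0// invr_gt0.
have /choice[N NP] i : exists N, forall n, (N <= n)%N -> alpha n * 2 ^+ i <= b i.
  have p2 : 0 < (2 : R) ^+ i by rewrite exprn_gt0.
  have d0 : 0 < b i / 2 ^+ i by rewrite divr_gt0.
  have [N _ aN] : \forall n \near \oo, `|alpha n| < b i / 2 ^+ i.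
    exact: cvgr0_norm_lt.
  exists N => n /aN /=; rewrite ltr_pdivlMr// => /ltW; apply: le_trans.
  by rewrite ler_wpM2r ?ler_norm// ltW.
pose c i := [seq (xy n, b i / alpha n) | n <- iota 0 (N i)].
have dU i : tau0_disk [set f : E | slopes_le (c i) f].
  by apply: tau0_disk_slopes_le => q t /mapP[n _ [_ ->]]; rewrite divr_gt0.
exists (fun i => [set f : E | slopes_le (c i) f]) => //.
move=> f [m _ [h hU ->]] n.
have hb i : alpha n * slope (h i) (xy n) <= b i.
  have dxy : 0 < mdist (xy n).1 (xy n).2 by rewrite mdist_gt0; exact/eqP/oxy.
  have [hi /scaled_Lip0_ballP h2] := hU i.
  have [nN|Nn] := ltnP n (N i).
    rewrite /slope mulrC -ler_pdivlMr// ler_pdivrMr//; apply: hi.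
    by apply/mapP; exists n => //; rewrite mem_iota.
  apply: le_trans (NP i n Nn); rewrite ler_wpM2l ?(ltW (a0 n))//.
  by rewrite /slope ler_pdivrMr.
rewrite (le_trans (ler_wpM2l (ltW (a0 n)) (slope_sum h (xy n))))// mulr_sumr.
rewrite (le_trans (ler_sum _ (fun i _ => hb i)))// -mulr_sumr.
by rewrite ler_piMr ?sum_half_powers// ltW.
Qed.

Lemma lip_seminormE alpha xy f : lip_seminorm alpha xy f =
  sup (range (fun n => alpha n * slope f (xy n))).
Proof. by []. Qed.

Lemma lip_seminorms0 (p : E -> R) : lip_seminorms k x0 p -> p 0 = 0.
Proof.
move=> [alpha [xy [_ _ _ ->]]]; rewrite -[RHS](@sup1 R); congr sup.
apply/seteqP; split => [_ [n _ <-]|_ ->].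
  by rewrite /= subrr modulus0 mul0r mulr0.
by exists 0%N => //; rewrite subrr modulus0 mul0r mulr0.
Qed.

Lemma mixed_nbhs_seminorm_ball (p : E -> R) g f e : lip_seminorms k x0 p ->
  p (f - g) < e -> nbhs (f : mixed_topology k x0) [set h | p (h - g) < e].
Proof.
move=> [alpha [xy [a0 acvg oxy ->]]] fe.
set p' := lip_seminorm alpha xy in fe *.
pose d := (e - p' (f - g)) / 2.
have d0 : 0 < d by rewrite divr_gt0// subr_gt0.
have [U dU small] := gamma_nbhs_small_slopes d0 a0 acvg oxy.
exists U; first exact: dU.
move=> _ [h Uh <-]; change (p' (f + h - g) < e).
apply: (@le_lt_trans _ _ (p' (f - g) + d)); last by rewrite /d; lra.
rewrite {1}/p' lip_seminormE; apply: ge_sup; first by eexists; exists 0%N.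
move=> _ [n _ <-].
have -> : slope (f + h - g) (xy n) = slope ((f - g) + h) (xy n) by rewrite addrAC.
rewrite (le_trans (ler_wpM2l (ltW (a0 n)) (slopeD _ _ _)))// mulrDr.
rewrite lerD ?small// /p' lip_seminormE; apply: ub_le_sup; last by exists n.
by have [] := lip_seminorm_has_sup (f - g) a0 acvg oxy.
Qed.

(** A function of the ball of radius [2 ^ i] that is small for the compact-open
    topology is a basic mixed neighbour of 0 on its own, as a sum whose only
    nonzero term has index i. *)
Lemma mixed_open_bounded_ptw_open A f : open (A : set (mixed_topology k x0)) ->
  bounded_ptw_open [set h | A (f + h)].
Proof.
rewrite openE => oA h r Ah; have [U dU UA] := oA _ Ah.
have [i ri] : exists i, r <= 2 ^+ i.
  by exists (Num.bound r); apply/ltW/upper_nthrootP.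
have [_ _ nU] := dU i.
have [e e0 [P PU]] := tau0_nbhs_lip r nU.
exists e => //; exists P => g rg gP; apply: UA.
have fg : f + h + (g - h) = f + g by rewrite [g - h]addrC addrA addrK.
exists (g - h); last exact: fg.
apply/gamma_nbhs_seq => //.
exists (fun j => if j == i then g - h else 0), i; split.
- move=> j; case: eqVneq => [->|_].
    split; first exact: PU.
    apply/scaled_Lip0_ballP => x y; rewrite (le_trans (rg x y))//.
    by rewrite ler_wpM2r ?mdist_ge0.
  split; first exact: tau0_disk0.
  by apply/scaled_Lip0_ballP => x y; rewrite subrr modulus0 mulr_ge0 ?mdist_ge0 ?exprn_ge0.
- by move=> j; rewrite ltn_neqAle eq_sym => /andP[/negPf->].
- by rewrite big_ord_recr/= eqxx big1 ?add0r// => j _; rewrite ltn_eqF.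
Qed.

(** Start of the induction on the radii: a small Lipschitz constant makes a
    function vanishing at the base point small at any given finite set of
    points. *)
Lemma small_lip_le_sub U : U 0 -> bounded_ptw_open U ->
  exists2 r, 0 < r & forall f, lip_le r f -> U f.
Proof.
move=> U0 openU; have [e e0 [P PU]] := openU 0 1 U0.
pose M := \sum_(p <- P) mdist p x0 + 1.
have M1 : 0 < M by rewrite ltr_wpDl ?sumr_ge0// => p _; exact: mdist_ge0.
exists (Num.min 1 (e / M)); first by rewrite lt_min ltr01 divr_gt0.
move=> f rf; apply: PU; rewrite ?subr0.
  move=> x y; rewrite (le_trans (rf x y))// ler_wpM2r ?mdist_ge0//.
  by rewrite ge_min lexx.
move=> p pP; rewrite /= subr0.
rewrite (le_lt_trans (lip_le_modulus _ (Lip0_at0 f) rf))//.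
apply: (@le_lt_trans _ _ (e / M * mdist p x0)).
  by rewrite ler_wpM2r ?mdist_ge0// ge_min lexx orbT.
rewrite mulrAC ltr_pdivrMr// ltr_pM2l// /M (big_rem p pP)/= -addrA ltr_pwDr//.
by rewrite ltr_wpDl// sumr_ge0// => q _; exact: mdist_ge0.
Qed.

(** With the weights [(r n)^-1] the inequality [p f < 1] implies all the slope
    bounds chosen for the radii r; as f lies in some ball, these bounds put it
    in U. *)
Lemma seminorm_ball_sub U (d : X * X) : offdiag d -> U 0 -> bounded_ptw_open U ->
  exists2 p, lip_seminorms k x0 p & forall f, p f < 1 -> U f.
Proof.
move=> dd U0 openU; have [s s0 sU] := small_lip_le_sub U0 openU.
pose r n : R := s * n.+1%:R.
have r0 n : 0 < r n by rewrite mulr_gt0.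
have [|F FU] := exists_slopes_sequence (r := r) openU.
  by move=> f; rewrite /r mulr1; exact: sU.
have rV0 n : 0 < (r n)^-1 by rewrite invr_gt0.
have rVcvg : (r n)^-1 @[n --> \oo] --> 0.
  rewrite -[0 in X in _ --> X](mulr0 s^-1).
  under eq_fun do rewrite /r invfM.
  by apply: cvgMr; exact: cvg_harmonic.
have [alpha [x [a0 acvg enum]]] := enumerate_finite_levels d F rV0 rVcvg.
(* The pairs chosen at each stage may be diagonal, where the slope bounds are
   vacuous; the seminorm requires distinct points, hence the replacement. *)
pose xy n := if (x n).1 == (x n).2 then d else x n.
have oxy n : offdiag (xy n) by rewrite /xy; case: eqP.
exists (lip_seminorm alpha xy); first by exists alpha, xy.
move=> f f1.
have [n Ln] : exists n, lip_le (r n) f.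
  exists (Num.bound (Lip f / s)) => y z.
  rewrite (le_trans (Lip0_lip_le f y z))// ler_wpM2r ?mdist_ge0//.
  rewrite /r mulrC -ler_pdivrMr// (le_trans (ltW (unstable.ltr_bound _)))//.
  by rewrite ler_nat.
apply: (FU n f Ln) => m _ q t /mapP[q' qF [-> ->]].
have [i [ai xi]] := enum _ _ qF.
have [->|q12] := eqVneq q'.1 q'.2.
  by rewrite subrr modulus0 mdistxx mulr0.
have : alpha i * slope f (xy i) < 1.
  apply: le_lt_trans f1; rewrite lip_seminormE; apply: ub_le_sup; last by exists i.
  by have [] := lip_seminorm_has_sup f a0 acvg oxy.
rewrite ai /xy xi (negPf q12) mulrC ltr_pdivrMr// mul1r.
by rewrite ltr_pdivrMr ?mdist_gt0// => /ltW.
Qed.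

End mixed.

(** * Topologies generated by semiballs *)

Section seminorm_topology.
Context {R : realType} {E : zmodType} (P : set (E -> R)).

Lemma open_seminorm_ball (p : E -> R) g e : P p -> 0 < e ->
  open ([set f | p (f - g) < e] : set (seminorm_topology P)).
Proof.
move=> Pp e0; set B := [set f | _].
exists [set B]; last by rewrite bigcup_set1.
move=> _ ->; exists (fset1 B) => //; last by rewrite set_fset1 bigcap_set1.
by move=> _ /[!inE] ->; exists p, g, e.
Qed.

(** The semiballs being a subbase, the filter F refines the neighbourhoods of f
    as soon as it contains each semiball around f. *)
Lemma seminorm_open_nbhs (A : set E) f (F : set_system E) : Filter F ->
  (forall p g e, P p -> p (f - g) < e -> F [set h | p (h - g) < e]) ->
  open (A : set (seminorm_topology P)) -> A f -> F A.
Proof.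
move=> FF Fball [D DP <-] [B DB Bf].
have [I subI IB] := DP _ DB.
apply: (@filterS _ F _ B); first by move=> h Bh; exists B.
rewrite -IB; apply: filter_bigI => C CI.
have /set_mem[p [g [e [Pp e0 CE]]]] := subI _ CI.
have : C f by move: Bf; rewrite -IB; exact.
by rewrite CE; exact: Fball.
Qed.

End seminorm_topology.

(** * Comparison of the two topologies *)

Theorem theorem3p4 (R : realType) (k : scalar_kind) (X : metricType R) (x0 : X)
    (A : set (Lip0 k x0)) :
  open (A : set (mixed_topology k x0)) <->
  open (A : set (seminorm_topology (lip_seminorms k x0))).
Proof.
split=> oA.
- rewrite openE => f Af.
  have [[d dd]|nod] := pselect (exists d : X * X, offdiag d); last first.
    rewrite (_ : A = setT); first exact: filterT.
    apply/seteqP; split => // g _; suff -> : g = f by [].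
    have x0E x : x = x0 by apply: contrapT => xx0; apply: nod; exists (x, x0).
    apply/val_inj/funext => x; rewrite (x0E x).
    exact: etrans (Lip0_at0 g) (esym (Lip0_at0 f)).
  have [|p Pp pA] := seminorm_ball_sub dd _ (mixed_open_bounded_ptw_open (f := f) oA).
    by rewrite /= addr0.
  have := open_seminorm_ball f Pp ltr01.
  move=> oB; apply: (@filterS _ _ _ [set h | p (h - f) < 1]); last first.
    apply: open_nbhs_nbhs; split => //=.
    by rewrite subrr (lip_seminorms0 Pp).
  by move=> h /pA /=; rewrite addrC subrK.
- rewrite openE => f Af.
  have FF : Filter (nbhs (f : mixed_topology k x0)) by exact: nbhs_filter.
  refine (seminorm_open_nbhs FF _ oA Af) => p g e.
  exact: mixed_nbhs_seminorm_ball.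
Qed.
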